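(* Let $G$ be a connected graph on at least $3$ vertices. Then $\chi_2(G)\le\lambda_1(G)^2+1$, with equality if and only if $G$ is a star or a Moore graph with diameter $2$ and girth $5$. Moreover, for every integer $\gamma\ge 3$, $\chi_\gamma(G)<\lambda_1(G)^\gamma+1$.
   Context: Graphs are finite and simple. $\lambda_1(G)$ is the spectral radius (largest eigenvalue) of the adjacency matrix of $G$. The $\gamma$-th power $G^\gamma$ of $G$ is the graph on the vertex set of $G$ in which two distinct vertices are adjacent if and only if their distance in $G$ is at most $\gamma$. $\chi_\gamma(G):=\chi(G^\gamma)$ is the chromatic number of $G^\gamma$. A Moore graph with diameter $2$ and girth $5$ is a regular graph with diameter $2$ and girth $5$ (if its degree is $\Delta$, it has $\Delta^2+1$ vertices). *)

(* Defs.v *)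
From mathcomp Require Import all_boot all_order all_algebra.
From mathcomp Require Import classical_sets reals.

Set Implicit Arguments.
Unset Strict Implicit.
Unset Printing Implicit Defensive.

Import Order.TTheory GRing.Theory Num.Theory.

(* A finite simple graph is a symmetric irreflexive relation on a finType. *)

Section Graphs.
Variables (T : finType) (e : rel T).

Definition connected_graph : Prop := forall x y : T, connect e x y.

Definition has_walk (n : nat) (x y : T) : bool :=
  [exists p : n.-tuple T, path e x p && (last x p == y)].

(* None stands for an infinite distance. Restricting to lengths below #|T| is
   harmless, as a shortest walk has no repeated vertex. *)
Definition distance (x y : T) : option nat :=
  ohead [seq n <- iota 0 #|T| | has_walk n x y].

Definition distance_le (x y : T) (d : nat) : bool :=
  if distance x y is Some n then n <= d else false.

Definition graph_power (g : nat) : rel T :=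
  fun x y => (x != y) && distance_le x y g.

Definition has_diameter (d : nat) : Prop :=
  (forall x y : T, distance_le x y d) /\
  (exists x y : T, distance x y = Some d).

Definition has_cycle (n : nat) : bool :=
  (2 < n) && [exists c : n.-tuple T, ucycleb e c].

(* None stands for an infinite girth; a cycle has at most #|T| vertices. *)
Definition girth : option nat :=
  ohead [seq n <- iota 0 #|T|.+1 | has_cycle n].

Definition regular : Prop := exists d : nat, forall x : T, #|e x| = d.

Definition moore_diameter2_girth5 : Prop :=
  [/\ regular, has_diameter 2 & girth = Some 5].

Definition is_star : Prop :=
  exists c : T, forall x y : T, e x y = (x != y) && ((x == c) || (y == c)).

Definition colorable (k : nat) : bool :=
  [exists f : {ffun T -> 'I_k}, [forall x, forall y, e x y ==> (f x != f y)]].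

(* An irreflexive relation is always #|T|-colorable, so the minimum is over a
   nonempty set containing the default value. *)
Definition chromatic_number : nat :=
  [arg min_(k < (ord_max : 'I_#|T|.+1) | colorable k) (k : nat)]%N.

End Graphs.

Definition chi_power (T : finType) (e : rel T) (g : nat) : nat :=
  chromatic_number (graph_power e g).

Local Open Scope ring_scope.

Definition adjacency_matrix (R : realType) (T : finType) (e : rel T) :
    'M[R]_#|T| :=
  \matrix_(i, j) (e (enum_val i) (enum_val j))%:R.

Definition largest_eigenvalue (R : realType) (n : nat) (A : 'M[R]_n) (a : R) :
    Prop :=
  eigenvalue A a /\ (forall b : R, eigenvalue A b -> b <= a).

(* The default 0 is only reached on the empty graph: a nonempty real symmetric
   matrix has a (unique) largest eigenvalue. *)
Definition lambda1 (R : realType) (T : finType) (e : rel T) : R :=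
  xget 0 (largest_eigenvalue (adjacency_matrix R e)).

(* Main.v *)
Require Import Defs.
From mathcomp Require Import boolp classical_sets reals.
From mathcomp Require Import topology normedtype derive.
From mathcomp Require Import all_boot all_order all_algebra.
From mathcomp Require Import ring lra.

Set Implicit Arguments.
Unset Strict Implicit.
Unset Printing Implicit Defensive.

Import Order.TTheory GRing.Theory Num.Theory.
Import numFieldNormedType.Exports.

(** Write A for the adjacency matrix, D for the diagonal matrix of degrees, B_k
    for the adjacency matrix of the k-th power, and l for [lambda1].

    The bound.  For k >= 1 the entrywise inequality B_(k+1) <= A B_k + A - D
    holds ([graph_power_covered]): off the diagonal, a pair at distance between
    2 and k+1 is joined by an edge followed by a path of length at most k, and
    a pair at distance 1 is taken care of by the summand A; on the diagonal
    A B_k has the degrees.  The Laplacian D - A is positive semidefinite, so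
    for f >= 0 the quadratic forms satisfy <f, B_(k+1) f> <= <A f, B_k f>, and
    by induction B_k has norm at most l^k ([dominated_power]).  If the k-th
    power is not c-colourable, a vertex-critical subset S exists in which every
    vertex has at least c neighbours ([critical_set]); testing the form on the
    indicator of S gives c <= l^k, which is the bound on the chromatic number.

    Equality.  If c = l^k, every inequality above is tight on the indicator of
    S.  Tightness of the Laplacian forces S to be everything by connectedness,
    and then B_(k+1) = A B_k + A - D holds entrywise and the power is c-regular
    ([critical_power_bound]).
    For powers at least 3 this is absurd: it would make every vertex pendant
    ([power_cover_not_tight]).  For the square it says that there are no
    triangles and no 4-cycles.  The square is c-regular and not c-colourable,
    so by a special case of the theorem of Brooks ([brooks_square]) it is
    complete, i.e. the diameter is at most 2; and the graphs of diameter at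
    most 2 without triangles and 4-cycles are the stars and the Moore graphs
    ([diameter2_classification]).  Conversely such a graph has row sums of A^2
    at most n - 1, hence l^2 <= n - 1, while its square needs n colours
    ([chi_square_eq]).

    The two facts about l that are used, that it is an eigenvalue and that it
    bounds the quadratic form of A, come from maximizing that form on the
    compact unit sphere ([lambda1_rayleigh]). *)

(** * Distances and powers *)

(** [distance] and [girth] are both of this form, so this turns either into the
    least natural number with a property. *)
Lemma ohead_filter_iotaP (P : pred nat) s m d :
  ohead [seq n <- iota s m | P n] = Some d <->
  [/\ s <= d < s + m, P d & forall i, s <= i < d -> ~~ P i].
Proof.
elim: m s => [|m IHm] s /=.
  split=> // -[/andP [sd ds]].
  by move: (leq_ltn_trans sd ds); rewrite addn0 ltnn.
case: ifP => Ps /=.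
  split=> [[<-]|[/andP [sd _] Pd Pmin]].
    split=> //; first by rewrite leqnn /= addnS ltnS leq_addr.
    by move=> i /andP [si is_]; move: (leq_ltn_trans si is_); rewrite ltnn.
  move: sd; rewrite leq_eqVlt => /predU1P [-> //|sd].
  by have := Pmin s; rewrite leqnn sd Ps => /(_ isT).
rewrite IHm addSnnS; split=> -[/andP [sd ds] Pd Pmin]; split=> //.
- by rewrite ds (ltnW sd).
- move=> i /andP [si id_]; move: si; rewrite leq_eqVlt => /predU1P [<-|si].
    by rewrite Ps.
  by apply: Pmin; rewrite si.
- rewrite ds andbT ltn_neqAle sd andbT.
  by apply/eqP => sdE; rewrite -sdE Ps in Pd.
- by move=> i /andP [si id_]; apply: Pmin; rewrite id_ (ltnW si).
Qed.

Section Distance.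
Variables (T : finType) (e : rel T).
Implicit Types (x y z : T) (k d : nat).

Lemma has_walkP n x y :
  reflect (exists p, [/\ size p = n, path e x p & last x p = y])
    (has_walk e n x y).
Proof.
apply: (iffP existsP) => [[p /andP [ep /eqP px]]|[p [pn ep px]]].
  by exists p; rewrite size_tuple.
by exists (Tuple (introT eqP pn)); rewrite ep px eqxx.
Qed.

Lemma distance_leP x y d :
  reflect (exists p, [/\ path e x p, last x p = y & size p <= d])
    (distance_le e x y d).
Proof.
rewrite /distance_le /distance; apply: (iffP idP) => [|[p [ep py pd]]].
  case E: (ohead _) => [n|] // nd.
  have [_ /has_walkP [p [pn ep px]] _] := (ohead_filter_iotaP _ _ _ _).1 E.
  by exists p; rewrite pn.
case: (shortenP ep) py => q eq uq sub_q qy.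
have wq : exists n, has_walk e n x y.
  by exists (size q); apply/has_walkP; exists q.
have qp : size q <= size p by apply: uniq_leq_size => //; case/andP: uq.
have q_lt : size q < #|T|.
  by have := max_card (mem (x :: q)); rewrite (card_uniqP uq).
case: (ex_minnP wq) => n wn n_min.
have nq : n <= size q by apply: n_min; apply/has_walkP; exists q.
have -> : ohead [seq n <- iota 0 #|T| | has_walk e n x y] = Some n.
  apply/ohead_filter_iotaP; split=> //=.
    by rewrite add0n (leq_ltn_trans nq).
  by move=> i iltn; apply: contraL iltn => /n_min; rewrite -leqNgt.
exact: leq_trans nq (leq_trans qp pd).
Qed.

Lemma distance_le0 x y : distance_le e x y 0 = (x == y).
Proof.
apply/distance_leP/eqP => [[[|z p] [_ <- //]]|->].
by exists [::].
Qed.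

Lemma distance_leS x y k :
  distance_le e x y k.+1 = (x == y) || [exists z, e x z && distance_le e z y k].
Proof.
apply/distance_leP/orP => [[[|z p] /=]|[/eqP ->|/existsP [z /andP [xz]]]].
- by case=> _ -> _; left.
- case=> /andP [xz ep] py pk; right; apply/existsP; exists z; rewrite xz.
  by apply/distance_leP; exists p.
- by exists [::].
- move=> /distance_leP [p [ep py pk]]; exists (z :: p).
  by rewrite /= xz.
Qed.

Lemma distance_le_refl x k : distance_le e x x k.
Proof. by apply/distance_leP; exists [::]. Qed.

Lemma distance_le_edge x y z k :
  e x z -> distance_le e z y k -> distance_le e x y k.+1.
Proof.
move=> xz zy; rewrite distance_leS; apply/orP; right.
by apply/existsP; exists z; rewrite xz.
Qed.

Lemma distance_le_mono x y k d :
  k <= d -> distance_le e x y k -> distance_le e x y d.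
Proof.
move=> kd /distance_leP [p [ep py pk]]; apply/distance_leP; exists p.
by split=> //; exact: leq_trans kd.
Qed.

Lemma distance_le_adj x y k : e x y -> distance_le e x y k.+1.
Proof. by move=> xy; exact: distance_le_edge xy (distance_le_refl y k). Qed.

Lemma connect_distance_le x y : connect e x y -> distance_le e x y #|T|.
Proof.
move=> /connectP [p ep ->]; case: (shortenP ep) => q eq uq _.
apply/distance_leP; exists q; split=> //; apply: ltnW.
by have := max_card (mem (x :: q)); rewrite (card_uniqP uq).
Qed.

Hypotheses (e_sym : symmetric e) (e_irr : irreflexive e).

Lemma adj_neq x y : e x y -> x != y.
Proof. by apply: contraTneq => ->; rewrite e_irr. Qed.

Lemma distance_le_sym x y k : distance_le e x y k = distance_le e y x k.
Proof.
suff sub a b : distance_le e a b k -> distance_le e b a k.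
  by apply/idP/idP; exact: sub.
move=> /distance_leP [p [ep pb pk]]; apply/distance_leP.
exists (rev (belast a p)); split; last by rewrite size_rev size_belast.
  by rewrite -pb rev_path (eq_path (e' := e)).
case: p {ep pk} pb => [|c p] /=; first by move=> ->.
by rewrite rev_cons last_rcons.
Qed.

Lemma distance_le2P x y :
  reflect [\/ x = y, e x y | exists2 z, e x z & e z y] (distance_le e x y 2).
Proof.
apply: (iffP idP) => [|[->|xy|[z xz zy]]].
- rewrite distance_leS => /predU1P [->|/existsP [z /andP [xz]]].
    by constructor 1.
  rewrite distance_leS => /predU1P [<-|/existsP [t /andP [zt]]].
    by constructor 2.
  by rewrite distance_le0 => /eqP ty; constructor 3; exists z; rewrite -?ty.
- exact: distance_le_refl.
- exact: distance_le_adj.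
- exact: distance_le_edge xz (distance_le_adj 0 zy).
Qed.

Local Notation P := (graph_power e).

Lemma graph_power_sym k : symmetric (P k).
Proof. by move=> x y; rewrite /graph_power eq_sym distance_le_sym. Qed.

Lemma graph_power_irr k : irreflexive (P k).
Proof. by move=> x; rewrite /graph_power eqxx. Qed.

Lemma graph_power_adj k x y : e x y -> P k.+1 x y.
Proof. by move=> xy; rewrite /graph_power adj_neq //= distance_le_adj. Qed.

Lemma graph_power1 x y : P 1 x y = e x y.
Proof.
apply/idP/idP => [|xy]; last exact: graph_power_adj.
rewrite /graph_power distance_leS => /andP [/negPf -> /= /existsP [z]].
by rewrite distance_le0 => /andP [xz /eqP <-].
Qed.

(** The entries of the product of the adjacency matrices of [e] and [b]. *)
Definition two_step (b : rel T) x y : nat := #|[pred z | e x z && b z y]|.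

(** The entrywise matrix inequality B' + D <= A B + A, where A, B, B' are the
    adjacency matrices of [e], [b], [b'] and D is the degree matrix of [e]. *)
Definition covered_by (b b' : rel T) : Prop :=
  forall x y, b' x y + (x == y) * #|e x| <= two_step b x y + e x y.

Lemma graph_power_covered k : covered_by (P k.+1) (P k.+2).
Proof.
move=> x y; have [<-|xy] := eqVneq x y.
  rewrite graph_power_irr e_irr mul1n add0n addn0.
  apply: subset_leq_card; apply/subsetP => z; rewrite !inE => xz.
  by rewrite [e x z]xz graph_power_adj // e_sym.
rewrite mul0n addn0; case Pxy: (P _ x y) => //.
have [//|nxy] := boolP (e x y); first by rewrite addn1.
rewrite addn0; apply: (@leq_trans 1) => //; apply/card_gt0P; move: Pxy.
rewrite /graph_power xy distance_leS (negPf xy) /=.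
case/existsP=> z /andP [xz zy].
exists z; rewrite !inE xz zy andbT; apply: contraNneq nxy => <-.
exact: xz.
Qed.

Hypothesis e_conn : connected_graph e.

Lemma connected_cut (A : pred T) x y : A x -> ~~ A y ->
  exists u w, [/\ A u, ~~ A w & e u w].
Proof.
move=> Ax; have /connectP [p ep ->] := e_conn x y.
elim: p x Ax ep => [|z p IHp] x Ax /=; first by rewrite Ax.
case/andP=> xz ep; have [Az|nAz] := boolP (A z); first exact: IHp ep.
by move=> _; exists x, z.
Qed.

Lemma exists_neighbour x : 1 < #|T| -> exists y, e x y.
Proof.
move=> T_gt1; have : exists y, y != x.
  apply/existsP; apply: contraTT T_gt1.
  rewrite negb_exists -leqNgt => /forallP xE.
  rewrite -(card1 x); apply: subset_leq_card; apply/subsetP => y _.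
  by move: (xE y); rewrite negbK inE.
case=> y yx; have [//|u [w [/eqP -> _ xw]]] :=
  @connected_cut (pred1 x) x y (eqxx x).
by exists w.
Qed.

End Distance.

(** * Colourings and critical sets *)

Section Colouring.
Variables (T : finType) (h : rel T).
Hypotheses (h_sym : symmetric h) (h_irr : irreflexive h).
Implicit Types (S : {set T}) (f : T -> nat).

Definition proper_on k S f : Prop :=
  {in S, forall x, f x < k} /\ {in S &, forall x y, h x y -> f x != f y}.

Lemma colorableP k :
  reflect (exists f, proper_on k setT f) (colorable h k).
Proof.
apply: (iffP existsP) => [[f /forallP fP]|[f [f_lt f_neq]]].
  exists (fun x => nat_of_ord (f x)); split=> [x _|x y _ _ xy].
    exact: ltn_ord.
  by have /forallP/(_ y)/implyP := fP x; apply.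
exists [ffun x => Ordinal (f_lt x (in_setT x))].
apply/forallP => x; apply/forallP => y; apply/implyP => xy.
by rewrite !ffunE -val_eqE /= f_neq.
Qed.

Lemma fresh_color (s : seq nat) k : size s < k -> exists2 c, c < k & c \notin s.
Proof.
move=> sk; have [/allP sub|/allPn [c]] := boolP (all (mem s) (iota 0 k)).
  have := uniq_leq_size (iota_uniq 0 k) sub.
  by rewrite size_iota leqNgt sk.
by rewrite mem_iota add0n => ck cs; exists c.
Qed.

Lemma proper_extend k S u f c : c < k -> proper_on k (S :\ u) f ->
    (forall z, z \in S -> h u z -> f z != c) ->
  proper_on k S (fun z => if z == u then c else f z).
Proof.
move=> ck [f_lt f_neq] fresh; split=> [z zS|z t zS tS zt].
  by case: ifP => // zu; apply: f_lt; rewrite !inE zu.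
case: ifP => zu; case: ifP => tu.
- by rewrite (eqP zu) (eqP tu) h_irr in zt.
- by rewrite eq_sym; apply: fresh => //; rewrite -(eqP zu).
- by apply: fresh => //; rewrite h_sym -(eqP tu).
- by apply: f_neq; rewrite ?inE ?zu ?tu.
Qed.

Lemma greedy_step k S u f : proper_on k (S :\ u) f ->
    #|[pred z in S | h u z]| < k ->
  exists2 c, c < k & proper_on k S (fun z => if z == u then c else f z).
Proof.
move=> fP deg_lt; pose s := [seq f z | z in [pred z in S | h u z]].
have [|c ck cs] := @fresh_color s k; first by rewrite size_map -cardE.
exists c => //; apply: proper_extend => // z zS uz.
by apply: contraNneq cs => <-; apply: image_f; rewrite inE zS.
Qed.

(** If every nonempty set had a vertex with fewer than [k] neighbours inside,
    removing such vertices one at a time and colouring them greedily in the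
    reverse order would colour the whole graph. *)
Lemma critical_set k : ~~ colorable h k ->
  exists2 S, S != set0 & {in S, forall x, k <= #|[pred y in S | h x y]|}.
Proof.
move=> ncol; have [|] := boolP [exists S : {set T}, (S != set0) &&
    [forall x in S, k <= #|[pred y in S | h x y]|]].
  by case/existsP=> S /andP [S0 /forall_inP SP]; exists S.
rewrite negb_exists => /forallP noS; case/negP: ncol; apply/colorableP.
have [n] := ubnP #|[set: T]|; elim: n [set: T] => // n IHn S.
rewrite ltnS => Sn; have [->|S0] := eqVneq S set0.
  by exists (fun=> 0); split=> x; rewrite inE.
have /forall_inPn [u uS] : ~~ [forall x in S, k <= #|[pred y in S | h x y]|].
  by have := noS S; rewrite S0.
rewrite -ltnNge => deg_lt; have [|f fP] := IHn (S :\ u).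
  by apply: leq_trans Sn; rewrite [X in _ < X](cardsD1 u) uS.
have [c _ cP] := greedy_step fP deg_lt.
by exists (fun z => if z == u then c else f z).
Qed.

Lemma colorable_card : colorable h #|T|.
Proof.
apply/existsP; exists [ffun x => enum_rank x].
apply/forallP => x; apply/forallP => y; apply/implyP => xy.
rewrite !ffunE; apply: contraTneq xy => /enum_rank_inj ->.
by rewrite h_irr.
Qed.

Lemma chromatic_numberP : colorable h (chromatic_number h) /\
  forall k, colorable h k -> chromatic_number h <= k.
Proof.
rewrite /chromatic_number; case: arg_minnP => [|k col_k k_min].
  exact: colorable_card.
split=> // m col_m; have [mT|/ltnW Tm] := ltnP m #|T|.+1.
  exact: (k_min (Ordinal mT)).
by apply: leq_trans Tm; rewrite -ltnS ltn_ord.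
Qed.

Lemma chromatic_number_complete :
  (forall x y, x != y -> h x y) -> chromatic_number h = #|T|.
Proof.
move=> complete; have [col_chi chi_min] := chromatic_numberP.
apply/eqP; rewrite eqn_leq chi_min ?colorable_card //=.
have /existsP [f /forallP fP] := col_chi.
rewrite -[X in _ <= X]card_ord; apply: (@leq_card _ _ f) => x y fxy.
apply: contraTeq (fP x) => xy; apply/forallPn; exists y.
by rewrite complete //= fxy eqxx.
Qed.

End Colouring.

(** * Colouring the square of a graph of diameter at least three *)

Section SquareColouring.
Variables (T : finType) (e : rel T).
Hypotheses (e_sym : symmetric e) (e_irr : irreflexive e).
Hypothesis e_conn : connected_graph e.

Local Notation P2 := (graph_power e 2).

Lemma graph_power2_via x y z : x != y -> e x z -> e z y -> P2 x y.
Proof.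
by move=> xy xz zy; rewrite /graph_power xy; apply/distance_le2P; constructor 3;
  exists z.
Qed.

(** The vertex [x] is at maximal distance [r.+1] from [a]. *)
Lemma exists_farthest a b k : ~~ distance_le e a b k ->
  exists x r, [/\ k <= r, ~~ distance_le e a x r &
    forall z, distance_le e a z r.+1].
Proof.
move=> ab; have all_d : exists d, [forall z, distance_le e a z d].
  by exists #|T|; apply/forallP => z; exact: connect_distance_le.
case: (ex_minnP all_d) => d /forallP ad d_min.
have kd : k < d.
  by rewrite ltnNge; apply: contra ab => dk; exact: distance_le_mono (ad b).
case: d kd ad d_min => // r kr ar r_min.
have /forallPn [x ax] : ~~ [forall z, distance_le e a z r].
  by apply/negP => /r_min; rewrite ltnn.
by exists x, r.
Qed.

(** Removing [x], a vertex farthest from [a], leaves a connected graph: the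
    inner vertices of a shortest path to [a] are closer to [a] than [x] is.
    Connectedness is again expressed by an edge across every cut. *)
Lemma cut_avoiding_farthest a x r (A : pred T) u w :
    ~~ distance_le e a x r -> (forall z, distance_le e a z r.+1) ->
    A u -> u != x -> ~~ A w -> w != x ->
  exists u' w', [/\ A u', ~~ A w', u' != x, w' != x & e u' w'].
Proof.
move=> ax ar.
have walk (B : pred T) z : ~~ B a -> B z -> z != x ->
    exists u' w', [/\ B u', ~~ B w', u' != x, w' != x & e u' w'].
  move=> nBa; have := ar z; rewrite distance_le_sym //.
  have [d dE] : exists d, d = r.+1 by exists r.+1.
  rewrite -dE; have {dE} : d <= r.+1 by rewrite dE.
  elim: d z => [|d IHd] z dr.
    by rewrite distance_le0 => /eqP ->; rewrite (negPf nBa).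
  rewrite distance_leS => /predU1P [->|/existsP [t /andP [zt ta]]] Bz zx.
    by rewrite Bz in nBa.
  have tx : t != x.
    apply: contraNneq ax => <-; rewrite distance_le_sym //.
    exact: distance_le_mono (dr : d <= r) ta.
  have [Bt|nBt] := boolP (B t); first exact: (IHd t (ltnW dr)).
  by exists z, t.
move=> Au ux nAw wx; have [Aa|nAa] := boolP (A a); last exact: (walk A u).
have [|//||w' [u' [nAw' Au' w'x u'x wu]]] := walk (predC A) w;
  rewrite /= ?negbK //.
by exists u', w'; rewrite -[A u']negbK e_sym.
Qed.

(** The configuration in the proof of Brooks' theorem by Lovasz: [x] and [y]
    are nonadjacent neighbours of [v] in the square, and the square stays
    connected when both are removed.  Take [x] farthest from [a] and [y] at
    distance 3 from [x].  The graph without [x] is connected, and removing the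
    further vertex [y] is harmless in the square, where the neighbours of [y]
    are adjacent to each other. *)
Lemma exists_brooks_triple a b : ~~ distance_le e a b 2 ->
  exists x y v, [/\ x != y, ~~ P2 x y, P2 v x, P2 v y &
    forall S : {set T}, x \in S -> y \in S -> v \notin S ->
      (exists2 u, u \in S & (u != x) && (u != y)) ->
      exists u w, [/\ u \in S, u != x, u != y, w \notin S & P2 u w]].
Proof.
move=> /exists_farthest [x [r [r2 ax ar]]].
have xa : ~~ distance_le e x a 2.
  by rewrite distance_le_sym //; apply: contra ax; exact: distance_le_mono.
have [v [y [xv xy vy]]] := connected_cut e_conn
  (A := fun z => distance_le e x z 2) (distance_le_refl e x 2) xa.
have x_neq_y : x != y by apply: contraNneq xy => <-; exact: distance_le_refl.
have vx : v != x.
  by apply: contraNneq xy => vx; apply: distance_le_adj; rewrite -vx.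
exists x, y, v; split=> //.
- by rewrite /graph_power negb_and (negPf xy) orbT.
- by rewrite /graph_power vx distance_le_sym.
- exact: graph_power_adj.
move=> S xS yS vS [u0 u0S /andP [u0x u0y]].
(* First put [y] on the side of [S]; if the edge found leaves from [y],
   put [y] on the other side and short-cut the two edges through [y]. *)
have [||u [w [/andP [uS _] wS ux wx uw]]] := cut_avoiding_farthest
  (A := fun z => (z \in S) && (z != x)) ax ar _ u0x _ vx.
- by rewrite u0S.
- by rewrite (negPf vS).
have {}wS : w \notin S by move: wS; rewrite wx andbT.
have [uy|uy] := eqVneq u y; last first.
  by exists u, w; split=> //; exact: graph_power_adj.
rewrite {u uS ux}uy in uw.
have [||u [t [/and3P [uS _ uy] tS ux tx ut]]] := cut_avoiding_farthest
  (A := fun z => [&& z \in S, z != x & z != y]) ax ar _ u0x _ vx.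
- by rewrite u0S u0x.
- by rewrite (negPf vS).
have [tS'|tS'] := boolP (t \in S); last first.
  by exists u, t; split=> //; exact: graph_power_adj.
move: tS; rewrite tS' tx /= negbK => /eqP ty; rewrite ty in ut.
exists u, w; split=> //; apply: graph_power2_via ut uw.
by apply: contraNneq wS => <-.
Qed.

(** Give [x] and [y] the same colour, and then colour towards [v].  A vertex
    other than [v] still has an uncoloured neighbour when its turn comes, and
    [v], which comes last, sees two neighbours of the same colour, so [k]
    colours are enough for vertices of degree at most [k]. *)
Lemma brooks_square k a b : ~~ distance_le e a b 2 ->
  (forall x, #|P2 x| <= k) -> colorable P2 k.
Proof.
move=> /exists_brooks_triple [x [y [v [x_neq_y xy vx vy cut]]]] deg_le.
have P_sym := graph_power_sym e_sym 2; have P_irr := graph_power_irr e 2.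
have k_gt0 : 0 < k.
  by apply: leq_trans (deg_le v); apply/card_gt0P; exists x.
have xv : v != x by apply: contraTneq vx => ->; rewrite P_irr.
have yv : v != y by apply: contraTneq vy => ->; rewrite P_irr.
have partial (S : {set T}) : x \in S -> y \in S -> v \notin S ->
    exists2 f, proper_on P2 k S f & f x = f y.
  have [n] := ubnP #|S|; elim: n S => // n IHn S; rewrite ltnS => Sn xS yS vS.
  have [/exists_inP S_big|] := boolP [exists u in S, (u != x) && (u != y)].
    have [u [w [uS ux uy wS uw]]] := cut S xS yS vS S_big.
    have [||||f fP fxy] := IHn (S :\ u).
    - by apply: leq_trans Sn; rewrite [X in _ < X](cardsD1 u) uS.
    - by rewrite !inE eq_sym ux.
    - by rewrite !inE eq_sym uy.
    - by rewrite !inE (negPf vS) andbF.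
    have [|c _ cP] := greedy_step P_sym P_irr fP (u := u).
      apply: leq_trans (deg_le u); apply: proper_card.
      apply/properP; split.
        by apply/subsetP => z; rewrite !inE => /andP [].
      by exists w; rewrite ?inE ?(negPf wS).
    exists (fun z => if z == u then c else f z) => //.
    by rewrite [x == u]eq_sym [y == u]eq_sym (negPf ux) (negPf uy).
  rewrite negb_exists_in => /forall_inP S_small.
  exists (fun=> 0) => //; split=> // z t zS tS.
  have := S_small _ zS; have := S_small _ tS.
  rewrite !negb_and !negbK => /orP [] /eqP -> /orP [] /eqP ->;
    by rewrite ?P_irr ?(negPf xy) // P_sym (negPf xy).
have [|||f fP fxy] := partial [set~ v].
- by rewrite !inE eq_sym.
- by rewrite !inE eq_sym.
- by rewrite !inE eqxx.
apply/colorableP.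
pose s := [seq f z | z in [pred z | P2 v z && (z != x)]].
have [|c ck cs] := @fresh_color s k.
  rewrite size_map -cardE; apply: leq_trans (deg_le v); apply: proper_card.
  apply/properP; split; first by apply/subsetP => z; rewrite !inE => /andP [].
  by exists x; rewrite ?inE ?eqxx ?andbF.
exists (fun z => if z == v then c else f z); apply: proper_extend => //.
  by rewrite setTD.
have fresh z : P2 v z -> z != x -> f z != c.
  by move=> vz zx; apply: contraNneq cs => <-; apply: image_f; rewrite inE vz.
move=> z _ vz; have [->|zx] := eqVneq z x; last exact: fresh.
by rewrite fxy; apply: fresh; rewrite // eq_sym.
Qed.

End SquareColouring.

(** * Graphs of diameter two without short cycles *)

Section DiameterTwo.
Variables (T : finType) (e : rel T).
Hypotheses (e_sym : symmetric e) (e_irr : irreflexive e).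

(** Any two distinct vertices are joined by at most one path of length at most
    2; this is girth at least 5, in the shape in which equality in the spectral
    bound delivers it. *)
Definition unique_short_paths : Prop :=
  forall x y, x != y -> two_step e e x y + e x y <= 1.

Definition triangle_free : Prop := forall x y z, e x y -> e y z -> ~~ e z x.

Definition square_free : Prop :=
  forall u v a b, u != v -> e u a -> e v a -> e u b -> e v b -> a = b.

Lemma unique_short_pathsP : unique_short_paths <-> triangle_free /\ square_free.
Proof.
split=> [few|[no3 no4] x y xy].
  split=> [x y z xy yz|u v a b uv ua va ub vb].
    apply/negP => zx; have := few _ _ (adj_neq e_irr xy).
    rewrite xy addn1 ltnS leqn0 => /eqP /card0_eq /(_ z).
    by rewrite !inE [e x z]e_sym zx [e z y]e_sym yz.
  have := few _ _ uv => /(leq_trans (leq_addr _ _)) /card_le1P.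
  move=> /(_ a); rewrite !inE ua e_sym va => /(_ isT b).
  by rewrite !inE ub e_sym vb => /esym /eqP ->.
have [exy|_] := boolP (e x y).
  rewrite addn1 ltnS leqn0; apply/eqP/eq_card0 => z; rewrite !inE.
  apply/negP => /andP [xz zy]; rewrite e_sym in zy.
  by have := no3 _ _ _ exy zy; rewrite e_sym xz.
rewrite addn0; apply/card_le1_eqP => a b; rewrite !inE.
move=> /andP [xa ay] /andP [xb yb].
by apply: (no4 x y); rewrite // e_sym.
Qed.

Lemma star_unique_short_paths : is_star e ->
  unique_short_paths /\ forall x y, distance_le e x y 2.
Proof.
case=> c star; split=> [|x y].
  apply/unique_short_pathsP; split=> [x y z|u v a b uv].
    rewrite !star => /andP [xy]; have [xc|xc /= /eqP yc] := eqVneq x c.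
      move=> _ /andP [yz /orP [/eqP yc|/eqP ->]]; last by rewrite xc eqxx.
      by rewrite xc yc eqxx in xy.
    rewrite yc eqxx => /andP [cz _].
    by rewrite [z == c]eq_sym (negPf cz) andbF.
  rewrite !star => /andP [ua /orP uac] /andP [va /orP vac] /andP [ub /orP ubc].
  move=> /andP [vb /orP vbc].
  have -> : a = c.
    case: uac vac => /eqP uc [] /eqP vc //.
    by rewrite uc vc eqxx in uv.
  case: ubc vbc => /eqP uc [] /eqP vc //.
  by rewrite uc vc eqxx in uv.
apply/distance_le2P; have [->|xy] := eqVneq x y; first by constructor 1.
have [xc|xc] := eqVneq x c; first by constructor 2; rewrite star xy xc eqxx.
have [yc|yc] := eqVneq y c.
  by constructor 2; rewrite star xy yc eqxx orbT.
constructor 3; exists c; first by rewrite star xc eqxx orbT.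
by rewrite star eq_sym yc eqxx.
Qed.

Lemma moore_unique_short_paths : moore_diameter2_girth5 e ->
  unique_short_paths /\ forall x y, distance_le e x y 2.
Proof.
case=> _ [diam2 _]; rewrite /girth => /ohead_filter_iotaP [_ _ no_cycle].
split=> //; apply/unique_short_pathsP.
split=> [x y z xy yz|u v a b uv ua va ub vb].
  apply/negP => zx; have := no_cycle 3 isT; case/negP.
  apply/andP; split=> //; apply/existsP; exists [tuple x; y; z].
  rewrite /ucycleb /= xy yz zx /= !inE negb_or (adj_neq e_irr xy).
  by rewrite (adj_neq e_irr yz) eq_sym (adj_neq e_irr zx).
apply/eqP; apply: contraT => ab; have := no_cycle 4 isT; case/negP.
apply/andP; split=> //; apply/existsP; exists [tuple u; a; v; b].
rewrite /ucycleb /= ua [e a v]e_sym va vb [e b u]e_sym ub /= !inE !negb_or.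
rewrite (adj_neq e_irr ua) uv (adj_neq e_irr ub) ab (adj_neq e_irr vb).
by rewrite [a == v]eq_sym (adj_neq e_irr va).
Qed.

Hypothesis e_conn : connected_graph e.
Hypothesis T_ge3 : 2 < #|T|.
Hypotheses (no3 : triangle_free) (no4 : square_free).
Hypothesis diam2 : forall x y, distance_le e x y 2.

(** All vertices are within distance 2 of the pendant vertex [v], hence
    adjacent to its only neighbour [u], and triangles are excluded. *)
Lemma pendant_star v u : e v u -> (forall w, e v w -> w = u) -> is_star e.
Proof.
move=> vu pendant; exists u.
have adj_u w : w != u -> e w u.
  case: (distance_le2P e v w (diam2 v w)) => [<- //|/pendant ->|[z]].
    by rewrite eqxx.
  by move=> /pendant ->; rewrite e_sym.
move=> x y; have [->|xu] := eqVneq x u.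
  have [->|yu] := eqVneq u y; first by rewrite e_irr.
  by rewrite e_sym adj_u // eq_sym.
have [->|yu] := eqVneq y u; first by rewrite adj_u // xu.
rewrite andbF; apply/negP => xy; have := no3 xy (adj_u _ yu).
by rewrite e_sym adj_u.
Qed.

(** A neighbour [z] of [x] is sent to itself if it is adjacent to [y], and
    otherwise to the common neighbour of [z] and [y].  Two values agreeing would
    create a triangle or a 4-cycle, so this is an injection between
    neighbourhoods. *)
Lemma nonadjacent_degree_le x y : x != y -> ~~ e x y -> #|e x| <= #|e y|.
Proof.
move=> xy nxy.
pose phi z := odflt z [pick t | e y t && ((t == z) || e z t)].
have phiP z : e x z -> e y (phi z) /\ (phi z = z \/ e z (phi z)).
  move=> xz; rewrite /phi; case: pickP => [t /andP [yt /predU1P]|none] //=.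
  have zy : z != y by apply: contraNneq nxy => <-.
  case: (distance_le2P e z y (diam2 z y)) => [/eqP|ezy|[t zt ty]].
  - by rewrite (negPf zy).
  - by have := none z; rewrite eqxx e_sym ezy.
  - by have := none t; rewrite e_sym ty zt orbT.
rewrite -(card_in_imset (f := phi) (D := e x)) => [|z1 z2]; last first.
  rewrite !unfold_in => xz1 xz2 eq_phi.
  have [yt1 t1] := phiP _ xz1; have [yt2 t2] := phiP _ xz2.
  rewrite -eq_phi in t2; apply/eqP; apply: contraT => z12.
  case: t1 t2 => [t1|z1t] [t2|z2t].
  - by rewrite -t1 t2 eqxx in z12.
  - by rewrite t1 in z2t; have := no3 xz2 z2t; rewrite e_sym xz1.
  - by rewrite t2 in z1t; have := no3 xz1 z1t; rewrite e_sym xz2.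
  - have tx : phi z1 = x by apply: (no4 z12); rewrite // e_sym.
    by rewrite tx e_sym (negPf nxy) in yt1.
apply: subset_leq_card; apply/subsetP => t /imsetP [z xz ->].
by have [] := phiP z xz.
Qed.

Lemma nonadjacent_degree x y : x != y -> ~~ e x y -> #|e x| = #|e y|.
Proof.
move=> xy nxy; apply/eqP; rewrite eqn_leq !nonadjacent_degree_le //.
  by rewrite eq_sym.
by rewrite e_sym.
Qed.

Hypothesis no_pendant : forall v u, e v u -> exists2 w, e v w & w != u.

(** Without pendant vertices every edge extends on both sides to a path
    [u', u, v, v'], which is induced as there are no triangles or 4-cycles. *)
Lemma path4 u v : e u v -> exists u' v',
  [/\ e u u', e v v', u' != v', u' != v & v' != u] /\
  [/\ ~~ e u' v, ~~ e v' u & ~~ e u' v'].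
Proof.
move=> uv; have [u' uu' u'v] := no_pendant uv.
have [v' vv' v'u] : exists2 w, e v w & w != u.
  by apply: no_pendant; rewrite e_sym.
have nu'v : ~~ e u' v by rewrite e_sym; apply: (no3 _ uv); rewrite e_sym.
have nv'u : ~~ e v' u by exact: no3 uv vv'.
exists u', v'; split; split=> //.
  by apply: contraNneq nu'v => ->; rewrite e_sym.
apply: contraNN v'u => u'v'; apply/eqP.
by apply: (no4 u'v); rewrite // e_sym.
Qed.

(** Nonadjacent vertices have equal degrees.  For adjacent [x] and [y], the
    complement of the induced path [x', x, y, y'] is a path from [x] to [y]
    through [y'] and [x'], along which the degree is constant. *)
Lemma diameter2_regular : regular e.
Proof.
have [x _] : exists x : T, x \in T by apply/card_gt0P; exact: leq_trans T_ge3.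
exists #|e x| => y; have [-> //|xy] := eqVneq x y.
have [exy|nxy] := boolP (e x y); last by rewrite (nonadjacent_degree xy).
have [x' [y' [[xx' yy' x'y' x'y y'x] [nx'y ny'x nx'y']]]] := path4 exy.
by rewrite -(nonadjacent_degree x'y nx'y) (nonadjacent_degree x'y' nx'y')
  (nonadjacent_degree y'x ny'x).
Qed.

(** The ends of the induced path [u', u, v, v'] have a common neighbour [w],
    which closes it to a 5-cycle. *)
Lemma diameter2_moore : moore_diameter2_girth5 e.
Proof.
have [u _] : exists x : T, x \in T by apply/card_gt0P; exact: leq_trans T_ge3.
have [v uv] := exists_neighbour e_conn u (ltnW T_ge3).
have [u' [v' [[uu' vv' u'v' u'v v'u] [nu'v nv'u nu'v']]]] := path4 uv.
split; first exact: diameter2_regular.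
  split=> //; exists u', v; have := diam2 u' v.
  have le_dist n : distance e u' v = Some n -> distance_le e u' v n.
    by rewrite /distance_le => ->.
  rewrite {1}/distance_le.
  case: distance le_dist => // -[|[|[|//]]] le_dist _ //.
    by have := le_dist 0 erefl; rewrite distance_le0 (negPf u'v).
  have := le_dist 1 erefl; rewrite distance_leS (negPf u'v) => /existsP [z].
  by rewrite distance_le0 => /andP [u'z /eqP zv]; rewrite -zv u'z in nu'v.
have [w u'w wv'] : exists2 w, e u' w & e w v'.
  case: (distance_le2P e u' v' (diam2 u' v')) => [/eqP|u'v'_adj|//].
    by rewrite (negPf u'v').
  by rewrite u'v'_adj in nu'v'.
have wu : w != u by apply: contraNneq nv'u => <-; rewrite e_sym.
have wv : w != v by apply: contraNneq nu'v => <-.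
have c_uniq : uniq [:: u'; u; v; v'; w].
  rewrite /= !inE !negb_or [u' == u]eq_sym (adj_neq e_irr uu') u'v u'v'.
  rewrite (adj_neq e_irr u'w) (adj_neq e_irr uv) [u == v']eq_sym v'u.
  rewrite [u == w]eq_sym wu (adj_neq e_irr vv') [v == w]eq_sym wv.
  by rewrite [v' == w]eq_sym (adj_neq e_irr wv').
apply/ohead_filter_iotaP; split.
- rewrite add0n ltnS /=; have := max_card (mem [:: u'; u; v; v'; w]).
  by rewrite (card_uniqP c_uniq).
- apply/existsP; exists [tuple u'; u; v; v'; w].
  rewrite /ucycleb c_uniq /= [e u' u]e_sym uu' uv vv' [e v' w]e_sym wv'.
  by rewrite e_sym u'w.
- case=> [|[|[|[|[|//]]]]] // _; apply/negP => /andP [_ /existsP [c]].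
    case: c => -[|x [|y [|z []]]] // sz; rewrite /ucycleb /= andbT.
    case/andP => /and3P [xy yz zx] _.
    by have := no3 xy yz; rewrite zx.
  case: c => -[|x [|y [|z [|t []]]]] // sz.
  rewrite /ucycleb /= !inE !negb_or !andbT.
  case/andP => /and4P [xy yz zt tx] /and3P [/and3P [_ xz _] /andP [_ yt] _].
  by case/eqP: yt; apply: (no4 xz); rewrite // e_sym.
Qed.

End DiameterTwo.

Lemma diameter2_classification (T : finType) (e : rel T) :
    symmetric e -> irreflexive e -> connected_graph e -> 2 < #|T| ->
  unique_short_paths e /\ (forall x y, distance_le e x y 2) <->
  is_star e \/ moore_diameter2_girth5 e.
Proof.
move=> e_sym e_irr e_conn T_ge3; split; last first.
  by case; [exact: star_unique_short_paths|exact: moore_unique_short_paths].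
case=> /(unique_short_pathsP e_sym e_irr) [no3 no4] diam2.
pose pendant v u := e v u && [forall w, e v w ==> (w == u)].
have [/existsP [v /existsP [u /andP [vu /forallP vP]]]|nopend] :=
    boolP [exists v, exists u, pendant v u].
  by left; apply: (pendant_star e_sym e_irr no3 diam2 vu) => w vw;
    have := vP w; rewrite vw => /eqP.
right; apply: diameter2_moore => // v u vu.
move: nopend; rewrite negb_exists => /forallP /(_ v).
rewrite negb_exists => /forallP /(_ u); rewrite /pendant vu /=.
rewrite negb_forall => /existsP [w]; rewrite negb_imply => /andP [vw wu].
by exists w.
Qed.

Local Open Scope ring_scope.

(** * The largest eigenvalue of a symmetric matrix *)

Section TopEigenvalue.
Variables (R : realType) (n : nat).
Implicit Types (u v w : 'rV[R]_n) (M : 'M[R]_n).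

(** The dot product of row vectors, real-valued rather than 1 x 1 matrices. *)
Definition dotr u v : R := \sum_i u 0 i * v 0 i.

Lemma dotrC u v : dotr u v = dotr v u.
Proof. by apply: eq_bigr => i _; rewrite mulrC. Qed.

Lemma dotrDl u v w : dotr (u + v) w = dotr u w + dotr v w.
Proof. by rewrite -big_split; apply: eq_bigr => i _; rewrite mxE mulrDl. Qed.

Lemma dotrZl a u w : dotr (a *: u) w = a * dotr u w.
Proof. by rewrite mulr_sumr; apply: eq_bigr => i _; rewrite mxE mulrA. Qed.

Lemma dotrDr u v w : dotr w (u + v) = dotr w u + dotr w v.
Proof. by rewrite dotrC dotrDl !(dotrC w). Qed.

Lemma dotrZr a u w : dotr w (a *: u) = a * dotr w u.
Proof. by rewrite dotrC dotrZl dotrC. Qed.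

Lemma dotr_ge0 u : 0 <= dotr u u.
Proof. by apply: sumr_ge0 => i _; rewrite -expr2 sqr_ge0. Qed.

Lemma dotr_eq0 u : (dotr u u == 0) = (u == 0).
Proof.
apply/idP/eqP => [|->]; last first.
  by apply/eqP; rewrite /dotr big1 // => i _; rewrite mxE mul0r.
rewrite psumr_eq0; last by move=> i _; rewrite -expr2 sqr_ge0.
move=> /allP u0; apply/rowP => i; rewrite mxE.
by move: (u0 i (mem_index_enum i)) => /=; rewrite mulf_eq0 orbb => /eqP.
Qed.

Lemma dotr_mulmxl M u v : M^T = M -> dotr (u *m M) v = dotr u (v *m M).
Proof.
move=> Msym; rewrite /dotr.
under eq_bigr => i _ do rewrite mxE mulr_suml.
under [RHS]eq_bigr => i _ do rewrite mxE mulr_sumr.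
rewrite exchange_big; apply: eq_bigr => i _; apply: eq_bigr => j _.
by rewrite -{1}Msym mxE; ring.
Qed.

Lemma dotr_continuous (f g : 'rV[R]_n -> 'rV[R]_n) :
    (forall i, continuous (fun v => f v 0 i)) ->
    (forall i, continuous (fun v => g v 0 i)) ->
  continuous (fun v => dotr (f v) (g v)).
Proof.
move=> cf cg; apply: continuous_big => [|i _ v]; first exact: add_continuous.
by apply: continuousM; [exact: cf|exact: cg].
Qed.

Local Open Scope classical_set_scope.

Lemma sphere_compact : compact [set v : 'rV[R]_n | dotr v v = 1].
Proof.
have cube := @rV_compact R n (fun=> `[(- 1), 1]%classic)
  (fun=> @segment_compact R (-1) 1).
apply: subclosed_compact cube _.
  apply: (preimage_closed (f := fun v => dotr v v) (D := [set x | x = 1]));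
    last exact: closed_eq.
  by move=> v _; apply: dotr_continuous => i; exact: coord_continuous.
move=> v /= v1 i; rewrite /= in_itv /= -ler_norml -(@ler_pXn2r _ 2) ?nnegrE //.
rewrite expr1n real_normK ?num_real // -v1 /dotr (bigD1 i) //= -expr2 lerDl.
by apply: sumr_ge0 => j _; rewrite -expr2 sqr_ge0.
Qed.

Lemma rayleigh_max M : (0 < n)%N ->
  exists2 v, dotr v v = 1 &
    forall u, dotr (u *m M) u <= dotr (v *m M) v * dotr u u.
Proof.
move=> n_gt0.
have [||v /set_mem /= v1 vmax] := @EVT_max_rV R n (fun u => dotr (u *m M) u)
  [set v : 'rV[R]_n | dotr v v = 1] _ sphere_compact.
- exists (delta_mx 0 (Ordinal n_gt0)) => /=.
  rewrite /dotr (bigD1 (Ordinal n_gt0)) //= big1 => [|i /negPf i_neq].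
    by rewrite !mxE !eqxx addr0 mulr1.
  by rewrite !mxE i_neq andbF mulr0.
- apply: continuous_subspaceT; apply: dotr_continuous => i; last first.
    exact: coord_continuous.
  under [X in continuous X]eq_fun => u do rewrite mxE.
  apply: continuous_big => [|j _ u]; first exact: add_continuous.
  by apply: continuousM; [exact: coord_continuous|exact: cst_continuous].
exists v => // u; have [->|u0] := eqVneq u 0.
  rewrite mul0mx; have /eqP -> : dotr 0 0 == 0 by rewrite dotr_eq0.
  by rewrite mulr0.
have u_gt0 : 0 < dotr u u by rewrite lt_def dotr_eq0 u0 dotr_ge0.
pose s := Num.sqrt (dotr u u).
have s_gt0 : 0 < s by rewrite sqrtr_gt0.
have s2 : s ^+ 2 = dotr u u by rewrite sqr_sqrtr // ltW.
have := vmax (s^-1 *: u); rewrite in_setE /= -scalemxAl !dotrZl !dotrZr !mulrA.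
rewrite -expr2 exprVn s2 mulVf ?gt_eqF // => /(_ erefl).
by rewrite mulrC ler_pdivrMr.
Qed.

(** The maximizer [v] of the form on the sphere is an eigenvector: were
    [w := v *m M - a *: v] nonzero, moving from [v] a little in the direction
    [w] would make the Rayleigh quotient larger than its maximum [a]. *)
Lemma top_eigenvector M : M^T = M -> (0 < n)%N ->
  exists a, exists v, [/\ v != 0, v *m M = a *: v &
    forall u, dotr (u *m M) u <= a * dotr u u].
Proof.
move=> Msym n_gt0; have [v v1 vmax] := rayleigh_max M n_gt0.
set a := dotr (v *m M) v in vmax *.
exists a, v; split => //; first by rewrite -dotr_eq0 v1 oner_eq0.
pose w := v *m M - a *: v.
suff: w == 0 by rewrite subr_eq0 => /eqP.
rewrite -dotr_eq0; apply: contraT => w_neq0.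
have w_gt0 : 0 < dotr w w by rewrite lt_def w_neq0 dotr_ge0.
have wE : dotr (v *m M) w - a * dotr v w = dotr w w.
  by rewrite -dotrZl -[- _]mulN1r -dotrZl -dotrDl scaleN1r.
move: w {w_neq0} w_gt0 wE => w w_gt0 wE.
pose c := a * dotr w w - dotr (w *m M) w.
have c_ge0 : 0 <= c by rewrite subr_ge0.
(* The first-order gain is [2 * t * dotr w w] and the second-order loss is
   [t ^+ 2 * c], so this step is short enough. *)
pose t := dotr w w / (c + 1).
have c1 : 0 < c + 1 by lra.
have t_gt0 : 0 < t by rewrite divr_gt0.
have tE : t * (c + 1) = dotr w w by rewrite divfK // gt_eqF.
have := vmax (v + t *: w).
rewrite mulmxDl -scalemxAl !(dotrDl, dotrDr, dotrZl, dotrZr) v1 -/a.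
rewrite (dotr_mulmxl w v Msym) (dotrC w (v *m M)) (dotrC w v).
have : 0 < t * (t * (c + 1) + t) by rewrite mulr_gt0 // addr_gt0 // tE.
have -> : dotr (v *m M) w = dotr w w + a * dotr v w by rewrite -wE; ring.
move: tE; rewrite /c; nra.
Qed.

End TopEigenvalue.

(** * Quadratic forms on graphs *)

Section Forms.
Variables (R : realType) (T : finType).
Implicit Types (b e : rel T) (f g : T -> R) (mu : R).

Definition nbr_sum b f x : R := \sum_(y | b x y) f y.

Definition qform b f : R := \sum_x f x * nbr_sum b f x.

Definition sqnorm f : R := \sum_x f x ^+ 2.

Lemma sqnorm_ge0 f : 0 <= sqnorm f.
Proof. by apply: sumr_ge0 => x _; exact: sqr_ge0. Qed.

Lemma adjacency_mulmx e (v : 'rV[R]_#|T|) j : symmetric e ->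
  (v *m adjacency_matrix R e) 0 j =
  nbr_sum e (fun x => v 0 (enum_rank x)) (enum_val j).
Proof.
move=> e_sym; rewrite mxE (reindex enum_rank) /=;
  last by apply: onW_bij; exact: enum_rank_bij.
rewrite /nbr_sum [RHS]big_mkcond /=.
apply: eq_bigr => x _; rewrite mxE enum_rankK e_sym.
by case: ifP; rewrite ?mulr1 ?mulr0.
Qed.

Lemma dotr_sqnorm (v : 'rV[R]_#|T|) :
  dotr v v = sqnorm (fun x => v 0 (enum_rank x)).
Proof.
rewrite /dotr (reindex enum_rank) /=;
  last by apply: onW_bij; exact: enum_rank_bij.
by apply: eq_bigr => x _; rewrite expr2.
Qed.

Lemma dotr_qform e (v : 'rV[R]_#|T|) : symmetric e ->
  dotr (v *m adjacency_matrix R e) v = qform e (fun x => v 0 (enum_rank x)).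
Proof.
move=> e_sym; rewrite /dotr (reindex enum_rank) /=;
  last by apply: onW_bij; exact: enum_rank_bij.
by apply: eq_bigr => x _; rewrite adjacency_mulmx // enum_rankK mulrC.
Qed.

(** The two facts about [lambda1] on which everything rests.  They are stated
    for functions on the vertices, which removes the enumeration of the
    vertices that the matrix carries. *)
Lemma lambda1_rayleigh e : symmetric e -> (0 < #|T|)%N ->
  (forall f, qform e f <= lambda1 R e * sqnorm f) /\
  exists2 f : T -> R, (exists x, f x != 0) &
    forall x, nbr_sum e f x = lambda1 R e * f x.
Proof.
move=> e_sym T_gt0; pose A := adjacency_matrix R e.
have A_sym : A^T = A by apply/matrixP => i j; rewrite !mxE e_sym.
have [a [v [v0 vA amax]]] := top_eigenvector A_sym T_gt0.
have a_top : largest_eigenvalue A a.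
  split=> [|b /eigenvalueP [u uA u0]]; first by apply/eigenvalueP; exists v.
  have u_gt0 : 0 < dotr u u by rewrite lt_def dotr_eq0 u0 dotr_ge0.
  by rewrite -(ler_pM2r u_gt0) -dotrZl -uA.
have -> : lambda1 R e = a.
  apply: xget_unique => // b [b_eig b_max]; apply/eqP.
  by rewrite eq_le b_max ?(a_top.2 b) // (a_top.1).
split=> [f|].
  have := amax (\row_i f (enum_val i)); rewrite dotr_qform // dotr_sqnorm.
  have fE : (fun x => (\row_i f (enum_val i)) 0 (enum_rank x)) = f.
    by apply/funext => x; rewrite mxE enum_rankK.
  by rewrite fE.
exists (fun x => v 0 (enum_rank x)) => [|x].
  have /rV0Pn [i vi] := v0.
  by exists (enum_val i); rewrite enum_valK.
by rewrite -[in LHS](enum_rankK x) -adjacency_mulmx // vA mxE.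
Qed.

Definition inner f g : R := \sum_x f x * g x.

Lemma natr_card (P : pred T) : #|P|%:R = \sum_x (P x)%:R :> R.
Proof.
rewrite -sum1_card natr_sum big_mkcond; apply: eq_bigr => x _.
by rewrite unfold_in; case: (P x).
Qed.

Lemma nbr_sumE b f x : nbr_sum b f x = \sum_y (b x y)%:R * f y.
Proof.
rewrite /nbr_sum big_mkcond; apply: eq_bigr => y _.
by case: ifP; rewrite ?mul1r ?mul0r.
Qed.

Lemma nbr_sumD b f g s x :
  nbr_sum b (fun y => f y + s * g y) x = nbr_sum b f x + s * nbr_sum b g x.
Proof. by rewrite /nbr_sum big_split -mulr_sumr. Qed.

Lemma inner_nbr_sumC b f g : symmetric b ->
  inner f (nbr_sum b g) = inner g (nbr_sum b f).
Proof.
move=> b_sym; rewrite /inner.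
under eq_bigr => x _ do rewrite nbr_sumE mulr_sumr.
under [RHS]eq_bigr => x _ do rewrite nbr_sumE mulr_sumr.
rewrite exchange_big; apply: eq_bigr => x _; apply: eq_bigr => y _.
by rewrite b_sym; ring.
Qed.

Lemma qformD b f g s : symmetric b ->
  qform b (fun x => f x + s * g x) =
  qform b f + 2 * s * inner g (nbr_sum b f) + s ^+ 2 * qform b g.
Proof.
move=> b_sym; rewrite mulr2n !mulrDl mul1r {1}(inner_nbr_sumC g f b_sym).
rewrite /qform /inner !mulr_sumr -!big_split; apply: eq_bigr => x _ /=.
by rewrite nbr_sumD; ring.
Qed.

Lemma sqnormD f g s :
  sqnorm (fun x => f x + s * g x) =
  sqnorm f + 2 * s * inner f g + s ^+ 2 * sqnorm g.
Proof.
rewrite /sqnorm /inner !mulr_sumr -!big_split; apply: eq_bigr => x _ /=.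
by ring.
Qed.

(** Nonnegative functions are enough to bound the form, as [b] has nonnegative
    entries; and entrywise comparison of matrices gives comparison of forms
    only on such functions. *)
Definition dominated b mu : Prop :=
  forall f, (forall x, 0 <= f x) -> qform b f <= mu * sqnorm f.

Lemma dominated_abs b mu f : dominated b mu -> `|qform b f| <= mu * sqnorm f.
Proof.
move=> b_mu; have -> : sqnorm f = sqnorm (fun x => `|f x|).
  by apply: eq_bigr => x _; rewrite real_normK ?num_real.
apply: le_trans (b_mu _ _) => //; apply: le_trans (ler_norm_sum _ _ _) _.
apply: ler_sum => x _; rewrite normrM ler_wpM2l //.
exact: ler_norm_sum.
Qed.

(** A bound on the form of a symmetric matrix bounds its operator norm: with
    [g := nbr_sum b f], compare the forms at [f + g / mu] and [f - g / mu],
    whose difference is [4 * sqnorm g / mu]. *)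
Lemma dominated_nbr_sum b mu f : symmetric b -> 0 < mu -> dominated b mu ->
  sqnorm (nbr_sum b f) <= mu ^+ 2 * sqnorm f.
Proof.
move=> b_sym mu_gt0 b_mu; set g := nbr_sum b f.
have := le_trans (ler_norm _) (dominated_abs (fun x => f x + mu^-1 * g x) b_mu).
have := le_trans (ler_norm _)
  (eq_ind_r (fun r => r <= _)
     (dominated_abs (fun x => f x + - mu^-1 * g x) b_mu) (normrN _)).
rewrite !qformD // !sqnormD -/g.
have -> : inner g g = sqnorm g by apply: eq_bigr => x _; rewrite expr2.
set F := qform b f; set G := qform b g; set n := sqnorm g; set m := sqnorm f.
move=> le1 le2.
have muK : mu * mu^-1 = 1 by rewrite mulfV // gt_eqF.
have {le1 le2} : 4 * mu^-1 * n <= 2 * mu * m + 2 * (mu * mu^-1) * mu^-1 * n.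
  by move: le1 le2; nra.
rewrite muK mulr1 => le3.
have {le3} : mu^-1 * n <= mu * m by lra.
rewrite -(ler_pM2l mu_gt0) mulrA muK mul1r => /le_trans; apply.
by rewrite expr2 mulrA.
Qed.

(** The Cauchy-Schwarz inequality, as nonnegativity of
    [sqnorm (mu * p - la * q)]. *)
Lemma dominated_inner a b la mu f :
    symmetric a -> symmetric b -> 0 < la -> 0 < mu ->
    dominated a la -> dominated b mu ->
  inner (nbr_sum a f) (nbr_sum b f) <= la * mu * sqnorm f.
Proof.
move=> a_sym b_sym la_gt0 mu_gt0 a_la b_mu.
have := dominated_nbr_sum f a_sym la_gt0 a_la.
have := dominated_nbr_sum f b_sym mu_gt0 b_mu.
set p := nbr_sum a f; set q := nbr_sum b f => q_le p_le.
have : 0 <= sqnorm (fun x => mu * p x + (- la) * q x) by exact: sqnorm_ge0.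
rewrite sqnormD.
have -> : sqnorm (fun x => mu * p x) = mu ^+ 2 * sqnorm p.
  by rewrite /sqnorm mulr_sumr; apply: eq_bigr => x _; rewrite exprMn.
have -> : inner (fun x => mu * p x) q = mu * inner p q.
  by rewrite /inner mulr_sumr; apply: eq_bigr => x _; rewrite mulrA.
move=> sq_ge0.
have q_le' : la ^+ 2 * sqnorm q <= la ^+ 2 * (mu ^+ 2 * sqnorm f).
  by rewrite ler_wpM2l // sqr_ge0.
have p_le' : mu ^+ 2 * sqnorm p <= mu ^+ 2 * (la ^+ 2 * sqnorm f).
  by rewrite ler_wpM2l // sqr_ge0.
rewrite -(ler_pM2l (mulr_gt0 la_gt0 mu_gt0)).
by move: sq_ge0 q_le' p_le'; nra.
Qed.

Definition dirichlet e f : R :=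
  \sum_x \sum_y (e x y)%:R * (f x - f y) ^+ 2.

Lemma dirichlet_ge0 e f : 0 <= dirichlet e f.
Proof.
by apply: sumr_ge0 => x _; apply: sumr_ge0 => y _; rewrite mulr_ge0 ?sqr_ge0.
Qed.

Lemma qformE b f : qform b f = \sum_x \sum_y (b x y)%:R * (f x * f y).
Proof.
apply: eq_bigr => x _; rewrite nbr_sumE mulr_sumr.
by apply: eq_bigr => y _; rewrite mulrCA.
Qed.

(** The quadratic form of the Laplacian as a sum of squares. *)
Lemma dirichletE e f : symmetric e ->
  dirichlet e f = 2 * (\sum_x #|e x|%:R * f x ^+ 2 - qform e f).
Proof.
move=> e_sym; pose F x y := (e x y)%:R * f x ^+ 2.
have FE : \sum_x \sum_y F x y = \sum_x #|e x|%:R * f x ^+ 2.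
  by apply: eq_bigr => x _; rewrite -mulr_suml natr_card.
have FE' : \sum_x \sum_y F y x = \sum_x #|e x|%:R * f x ^+ 2.
  by rewrite exchange_big.
rewrite mulrBr [X in X - _]mulr_natl mulr2n -{1}FE -FE' qformE mulr_sumr.
rewrite -big_split -sumrB; apply: eq_bigr => x _ /=.
rewrite mulr_sumr -big_split -sumrB; apply: eq_bigr => y _ /=.
by rewrite /F [e y x]e_sym; ring.
Qed.

Lemma inner_two_step e b f : symmetric e ->
  inner (nbr_sum e f) (nbr_sum b f) =
  \sum_x \sum_y (two_step e b x y)%:R * (f x * f y).
Proof.
move=> e_sym; rewrite /inner.
transitivity (\sum_z \sum_x \sum_y (e x z && b z y)%:R * (f x * f y)).
  apply: eq_bigr => z _; rewrite !nbr_sumE mulr_suml; apply: eq_bigr => x _.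
  rewrite mulr_sumr; apply: eq_bigr => y _.
  by rewrite -mulnb natrM e_sym; ring.
rewrite exchange_big; apply: eq_bigr => x _; rewrite exchange_big.
by apply: eq_bigr => y _; rewrite natr_card mulr_suml.
Qed.

Definition slack e b b' x y : nat :=
  two_step e b x y + e x y - (b' x y + (x == y) * #|e x|).

(** An exact account of what is lost in the bound: the Laplacian term and the
    entrywise defect of the matrix inequality.  Both vanish in the case of
    equality. *)
Lemma inner_slack e b b' f : symmetric e -> covered_by e b b' ->
  inner (nbr_sum e f) (nbr_sum b f) =
  qform b' f + dirichlet e f / 2 +
  \sum_x \sum_y (slack e b b' x y)%:R * (f x * f y).
Proof.
move=> e_sym cov; rewrite dirichletE // [2 * _]mulrC mulfK ?pnatr_eq0 //.
rewrite inner_two_step //.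
set M := LHS; set D := \sum_x #|e x|%:R * _.
set S := \sum_x \sum_y (slack _ _ _ _ _)%:R * _.
suff: M + qform e f = qform b' f + D + S by lra.
rewrite /M /D /S.
have -> : \sum_x #|e x|%:R * f x ^+ 2 =
    \sum_x \sum_y ((x == y) * #|e x|)%:R * (f x * f y).
  apply: eq_bigr => x _; rewrite (bigD1 x) //= eqxx mul1n expr2 big1 ?addr0 //.
  by move=> y; rewrite eq_sym => /negPf ->; rewrite mul0n mul0r.
rewrite !qformE -!big_split; apply: eq_bigr => x _.
rewrite -!big_split; apply: eq_bigr => y _ /=.
by rewrite -!mulrDl -!natrD -(subnKC (cov x y)) addnAC.
Qed.

Lemma sqnorm_indicator (S : {set T}) :
  sqnorm (fun x => (x \in S)%:R) = #|S|%:R.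
Proof.
rewrite -sum1_card natr_sum big_mkcond; apply: eq_bigr => x _.
by rewrite -natrX; case: (x \in S).
Qed.

Lemma qform_indicator b (S : {set T}) :
  qform b (fun x => (x \in S)%:R) = \sum_(x in S) #|[pred y in S | b x y]|%:R.
Proof.
rewrite [RHS]big_mkcond; apply: eq_bigr => x _.
case: ifP => _; rewrite ?mul0r // mul1r nbr_sumE natr_card.
by apply: eq_bigr => y _; rewrite /= -natrM mulnb andbC.
Qed.

Lemma dominated_step e b b' la mu : symmetric e -> symmetric b ->
    covered_by e b b' -> 0 < la -> 0 < mu ->
    dominated e la -> dominated b mu ->
  dominated b' (la * mu).
Proof.
move=> e_sym b_sym cov la_gt0 mu_gt0 e_la b_mu f f_ge0.
apply: le_trans (dominated_inner f e_sym b_sym la_gt0 mu_gt0 e_la b_mu).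
rewrite (inner_slack f e_sym cov) -addrA lerDl addr_ge0 //.
  by rewrite divr_ge0 ?dirichlet_ge0.
by apply: sumr_ge0 => x _; apply: sumr_ge0 => y _; rewrite !mulr_ge0.
Qed.

End Forms.

(** * The chromatic number of a power *)

Section PowerBound.
Variables (R : realType) (T : finType) (e : rel T).
Hypotheses (e_sym : symmetric e) (e_irr : irreflexive e).
Hypotheses (e_conn : connected_graph e) (T_ge3 : (2 < #|T|)%N).

Local Notation P := (graph_power e).
Local Notation lam := (lambda1 R e).

Let T_gt0 : (0 < #|T|)%N. Proof. exact: leq_trans T_ge3. Qed.

Lemma lambda1_gt0 : 0 < lam.
Proof.
have [bound _] := lambda1_rayleigh R e_sym T_gt0.
have := bound (fun x => (x \in [set: T])%:R).
rewrite sqnorm_indicator qform_indicator -natr_sum => le_lam.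
have [x _] : exists x : T, x \in T by apply/card_gt0P.
have [y xy] := exists_neighbour e_conn x (ltnW T_ge3).
have : 0 < lam * #|[set: T]|%:R.
  apply: lt_le_trans le_lam; rewrite ltr0n (bigD1 x) ?inE //= ltn_addr //.
  by apply/card_gt0P; exists y; rewrite !inE.
by rewrite pmulr_lgt0 // ltr0n cardsT.
Qed.

Lemma dominated_lambda1 : dominated e lam.
Proof.
by have [bound _] := lambda1_rayleigh R e_sym T_gt0 => f _; exact: bound.
Qed.

Lemma dominated_power k : dominated (P k.+1) (lam ^+ k.+1).
Proof.
elim: k => [|k IHk].
  move=> f f_ge0; rewrite expr1; apply: le_trans (dominated_lambda1 f_ge0).
  rewrite !qformE; apply: ler_sum => x _; apply: ler_sum => y _.
  by rewrite graph_power1.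
rewrite exprS; apply: dominated_step dominated_lambda1 IHk => //.
- exact: graph_power_sym.
- exact: graph_power_covered.
- exact: lambda1_gt0.
- by rewrite exprn_gt0 // lambda1_gt0.
Qed.

(** A function with zero Dirichlet form is constant on a connected graph. *)
Lemma dirichlet_eq0 (S : {set T}) : S != set0 ->
  dirichlet e (fun x => (x \in S)%:R : R) = 0 -> S = [set: T].
Proof.
move=> /set0Pn [x xS] dir0; apply/setP => y; rewrite inE.
apply: contraT => yS.
have [u [w [uS wS uw]]] := connected_cut e_conn (A := mem S) xS yS.
suff: 0 < dirichlet e (fun x => (x \in S)%:R : R) by rewrite dir0 ltxx.
rewrite /dirichlet (bigD1 u) //= ltr_pwDl //; last first.
  by apply: sumr_ge0 => ? _; apply: sumr_ge0 => ? _; rewrite mulr_ge0 ?sqr_ge0.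
rewrite (bigD1 w) //= ltr_pwDl //; last first.
  by apply: sumr_ge0 => ? _; rewrite mulr_ge0 ?sqr_ge0.
by rewrite uw /= in uS wS *; rewrite uS (negPf wS) subr0 expr1n mulr1 ltr01.
Qed.

(** Evaluate [inner_slack] at the indicator of a critical set [S].  In the case
    of equality its Dirichlet form vanishes, so [S] contains all vertices, and
    then the remaining terms can be read off vertex by vertex. *)
Lemma critical_power_bound k c : ~~ colorable (P k.+2) c ->
  c%:R <= lam ^+ k.+2 /\
  (c%:R = lam ^+ k.+2 -> (forall x, #|P k.+2 x| = c) /\
     forall x y, x != y ->
       (two_step e (P k.+1) x y + e x y <= P k.+2 x y)%N).
Proof.
have P_sym := graph_power_sym e_sym; have P_irr := graph_power_irr e.
move=> /(critical_set (P_sym _) (P_irr _)) [S S0 S_deg].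
pose f x : R := (x \in S)%:R.
have f_ge0 x : 0 <= f x by rewrite ler0n.
have S_gt0 : 0 < #|S|%:R :> R by rewrite ltr0n card_gt0.
have := dominated_inner f e_sym (P_sym k.+1) lambda1_gt0
  (exprn_gt0 k.+1 lambda1_gt0) dominated_lambda1 (dominated_power k).
rewrite -exprS (inner_slack f e_sym (graph_power_covered e_sym e_irr k)).
rewrite sqnorm_indicator qform_indicator.
set F := \sum_(x in S) _; set D := dirichlet e f; set W := \sum_x _.
have D_ge0 : 0 <= D by exact: dirichlet_ge0.
have W_ge0 : 0 <= W.
  by apply: sumr_ge0 => x _; apply: sumr_ge0 => y _; rewrite !mulr_ge0.
have F_ge : c%:R * #|S|%:R <= F.
  rewrite mulr_natr -sumr_const; apply: ler_sum => x xS.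
  by rewrite ler_nat S_deg.
move=> F_le; split=> [|cE].
  by rewrite -(ler_pM2r S_gt0); lra.
have D0 : D = 0 by rewrite -cE in F_le; lra.
have W0 : W = 0 by rewrite -cE in F_le; lra.
have F_eq : F = c%:R * #|S|%:R by rewrite -cE in F_le; lra.
have ST : S = [set: T] by exact: dirichlet_eq0.
have f1 x : f x = 1 by rewrite /f ST inE.
have degE x : #|[pred y in S | P k.+2 x y]| = #|P k.+2 x|.
  by apply: eq_card => y; rewrite !inE ST inE.
split=> [x|x y xy].
  have : \sum_(z in S) (#|[pred y in S | P k.+2 z y]|%:R - c%:R : R) = 0.
    rewrite sumrB sumr_const -[X in _ - X]mulr_natr; apply/eqP.
    by rewrite subr_eq0; apply/eqP.
  move/eqP; rewrite psumr_eq0 => [|z zS]; last first.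
    by rewrite subr_ge0 ler_nat S_deg.
  move=> /allP /(_ x (mem_index_enum x)).
  rewrite ST inE /= -ST degE subr_eq0 eqr_nat.
  by move=> /eqP.
have slack_ge0 (z t : T) :
    0 <= (slack e (P k.+1) (P k.+2) z t)%:R * (f z * f t).
  by rewrite !mulr_ge0.
move/eqP: W0; rewrite psumr_eq0 => [|z _]; last by apply: sumr_ge0.
move=> /allP /(_ x (mem_index_enum x)) /=; rewrite psumr_eq0 //.
move=> /allP /(_ y (mem_index_enum y)) /=; rewrite !f1 !mulr1 pnatr_eq0.
by rewrite /slack (negPf xy) mul0n addn0 subn_eq0.
Qed.

Lemma chi_power_bound k : exists2 c, chi_power e k.+2 = c.+1 &
  c%:R <= lam ^+ k.+2 /\
  (c%:R = lam ^+ k.+2 -> (forall x, #|P k.+2 x| = c) /\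
     forall x y, x != y ->
       (two_step e (P k.+1) x y + e x y <= P k.+2 x y)%N).
Proof.
have [col chi_min] := chromatic_numberP (graph_power_irr e k.+2).
rewrite /chi_power; case chiE: (chromatic_number _) => [|c].
  have [f [f_lt _]] := colorableP _ _ col; rewrite chiE in f_lt.
  have [x _] : exists x : T, x \in T by apply/card_gt0P.
  by have := f_lt x (in_setT x).
exists c => //; apply: critical_power_bound.
by apply/negP => /chi_min; rewrite chiE ltnn.
Qed.

(** The walks of length 2 from [x] that return to [x] are as many as the edges
    at [x].  Replacing them by these edges turns the count of walks of length 2
    into a count of paths of length 1 or 2, at most one to each other vertex. *)
Lemma unique_short_paths_two_step_sum x : unique_short_paths e ->
  (\sum_y two_step e e x y <= #|T|.-1)%N.
Proof.
move=> few; have cardE' : #|e x| = (\sum_y e x y)%N.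
  rewrite -sum1_card big_mkcond; apply: eq_bigr => y _.
  by rewrite unfold_in; case: (e x y).
rewrite -(leq_add2r #|e x|) {1}cardE' -big_split /=.
rewrite (bigD1 x) //= e_irr addn0 addnC leq_add //.
  have <- : #|predC1 x| = #|T|.-1 by rewrite cardC1.
  by rewrite -sum1_card; apply: leq_sum => y yx; apply: few; rewrite eq_sym.
by apply: subset_leq_card; apply/subsetP => y; rewrite !inE => /andP [].
Qed.

(** An eigenvalue of the square of the adjacency matrix is at most the largest
    row sum, seen at an entry of maximal modulus of the eigenvector. *)
Lemma unique_short_paths_lambda1_sq :
  unique_short_paths e -> lam ^+ 2 <= #|T|.-1%:R.
Proof.
move=> few; have [_ [f [x0 fx0] f_eig]] := lambda1_rayleigh R e_sym T_gt0.
have [x _ x_max] : exists2 x, true & forall y, `|f y| <= `|f x|.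
  case: (@arg_maxP _ R T x0 predT (fun x => `|f x|) isT) => x _ xm.
  by exists x => // y; exact: xm.
have fx_gt0 : 0 < `|f x| by apply: lt_le_trans (x_max x0); rewrite normr_gt0.
have sqE : lam ^+ 2 * f x = \sum_y (two_step e e x y)%:R * f y.
  rewrite expr2 -mulrA -f_eig nbr_sumE mulr_sumr.
  transitivity (\sum_z (e x z)%:R * nbr_sum e f z).
    by apply: eq_bigr => z _; rewrite f_eig mulrCA.
  under eq_bigr => z _ do rewrite nbr_sumE mulr_sumr.
  rewrite exchange_big; apply: eq_bigr => y _.
  rewrite natr_card mulr_suml; apply: eq_bigr => z _ /=.
  by rewrite mulrA -natrM mulnb.
rewrite -(ler_pM2r fx_gt0) -{1}[lam ^+ 2]ger0_norm ?sqr_ge0 // -normrM sqE.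
apply: le_trans (ler_norm_sum _ _ _) _.
apply: (@le_trans _ _ (\sum_y (two_step e e x y)%:R * `|f x|)).
  by apply: ler_sum => y _; rewrite normrM normr_nat ler_wpM2l.
rewrite -mulr_suml -natr_sum ler_wpM2r // ler_nat.
exact: unique_short_paths_two_step_sum.
Qed.

Lemma two_step_power1 x y : two_step e (P 1) x y = two_step e e x y.
Proof. by apply: eq_card => z; rewrite !inE graph_power1. Qed.

Lemma chi_square_eq :
  (chi_power e 2)%:R = lam ^+ 2 + 1 <->
  unique_short_paths e /\ forall x y, distance_le e x y 2.
Proof.
have [c chiE [c_le c_eq]] := chi_power_bound 0.
split=> [|[few diam2]].
  rewrite chiE -natr1 => /addIr /c_eq [deg slack0]; split=> [x y xy|x y].
    by rewrite -two_step_power1; apply: leq_trans (slack0 x y xy) (leq_b1 _).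
  apply: contraT => far.
  have col : colorable (P 2) c.
    by apply: (brooks_square e_sym e_irr e_conn far) => z; rewrite deg.
  have [_ chi_min] := chromatic_numberP (graph_power_irr e 2).
  by have := chi_min _ col; rewrite -/(chi_power e 2) chiE ltnn.
apply/eqP; rewrite eq_le {1}chiE -natr1 lerD2r c_le /=.
have -> : chi_power e 2 = #|T|.
  apply: chromatic_number_complete => [|x y xy]; first exact: graph_power_irr.
  by rewrite /graph_power xy diam2.
by rewrite -(prednK T_gt0) -natr1 lerD2r unique_short_paths_lambda1_sq.
Qed.

(** On an edge [x y], equality would leave no walk from [x] to [y] that starts
    with another neighbour [z] of [x]; but such a [z] is within distance 2 of
    [y].  So every vertex is pendant, and a connected graph with all vertices
    pendant has only two. *)
Lemma power_cover_not_tight k : ~ forall x y, x != y ->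
  (two_step e (P k.+2) x y + e x y <= P k.+3 x y)%N.
Proof.
move=> slack0.
have pendant x y z : e x y -> e x z -> z = y.
  move=> xy xz; apply/eqP; apply: contraT => zy.
  have := leq_trans (slack0 x y (adj_neq e_irr xy)) (leq_b1 _).
  rewrite xy addn1 ltnS leqn0 => /eqP two_step0.
  have := card0_eq two_step0 z; rewrite !inE xz /=.
  rewrite /graph_power zy /= => /negP; case.
  by apply: distance_le_edge (distance_le_adj _ xy); rewrite e_sym.
have [x _] : exists x : T, x \in T by apply/card_gt0P.
have [y xy] := exists_neighbour e_conn x (ltnW T_ge3).
have [z] : exists z, z \notin [set x; y].
  apply/existsP; apply: contraTT T_ge3.
  rewrite negb_exists -leqNgt => /forallP all_in.
  apply: (@leq_trans #|[set x; y]|); last by rewrite cards2; case: (x != y).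
  apply: subset_leq_card; apply/subsetP => z _.
  by have := all_in z; rewrite negbK.
have x_in : x \in [set x; y] by rewrite !inE eqxx.
move=> z_out; have [u [w [u_in w_out uw]]] :=
  connected_cut e_conn (A := fun t => t \in [set x; y]) x_in z_out.
case/negP: w_out; move: u_in; rewrite /= !inE => /orP [] /eqP uE; subst u.
  by rewrite (pendant _ _ _ xy uw) eqxx orbT.
by rewrite e_sym in xy; rewrite (pendant _ _ _ xy uw) eqxx.
Qed.

Lemma chi_power_lt k : (chi_power e k.+3)%:R < lam ^+ k.+3 + 1.
Proof.
have [c -> [c_le c_eq]] := chi_power_bound k.+1.
rewrite -natr1 ltrD2r lt_neqAle c_le andbT; apply/eqP => /c_eq [_].
exact: power_cover_not_tight.
Qed.

End PowerBound.

Theorem theorem3p5 (R : realType) (T : finType) (e : rel T)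
    (e_sym : symmetric e) (e_irr : irreflexive e)
    (e_conn : connected_graph e) (T_ge3 : (3 <= #|T|)%N) :
  [/\ (chi_power e 2)%:R <= lambda1 R e ^+ 2 + 1,
      (chi_power e 2)%:R = lambda1 R e ^+ 2 + 1 <->
        is_star e \/ moore_diameter2_girth5 e
    & forall g : nat, (3 <= g)%N ->
        (chi_power e g)%:R < lambda1 R e ^+ g + 1].
Proof.
split=> [||g].
- have [c -> [c_le _]] := chi_power_bound R e_sym e_irr e_conn T_ge3 0.
  by rewrite -natr1 lerD2r.
- rewrite chi_square_eq //; exact: diameter2_classification.
- by case: g => [|[|[|k]]] // _; exact: chi_power_lt.
Qed.
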